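(* Let $p>0$. The index $S_p$ has the rising tide property: for every $N\ge 1$, every vector $Y=(Y_1,\dots,Y_N)$ with positive entries and every constant $c\ge 0$, one has $S_p(Y+c)\le S_p(Y)$, where $Y+c=(Y_1+c,\dots,Y_N+c)$.
   Context: For a vector $Y=(Y_1,\dots,Y_N)$ with positive entries, let $r$ be a permutation of $\{1,\dots,N\}$ with $Y_{r_1}\le Y_{r_2}\le\dots\le Y_{r_N}$, and let $\bar Y=\frac1N\sum_{i=1}^N Y_i$. The Lorenz curve $L_Y:[0,1]\to\mathbb{R}$ is the piecewise linear interpolation of the points $\big(\frac kN,\sum_{i=1}^kY_{r_i}\big)$, $k=0,\dots,N$, and the dual Lorenz curve $L_Y^c:[0,1]\to\mathbb{R}$ is the piecewise linear interpolation of the points $\big(\frac kN,\sum_{i=1}^kY_{r_{N+1-i}}\big)$, $k=0,\dots,N$. For $p>0$, $$S_p(Y)=\frac{1}{N\bar Y}\Big(\int_0^1|L_Y^c(t)-L_Y(t)|^p\,dt\Big)^{1/p}.$$ *)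

(* Defs.v *)
From HB Require Import structures.
From mathcomp Require Import all_boot all_order all_fingroup all_algebra.
From mathcomp Require Import all_classical all_reals all_analysis.

Set Implicit Arguments.
Unset Strict Implicit.
Unset Printing Implicit Defensive.

Import Order.TTheory GRing.Theory Num.Theory.
Import numFieldNormedType.Exports.

Local Open Scope ring_scope.

Definition sorts (R : realType) (N : nat) (Y : 'rV[R]_N) (r : 'S_N) : bool :=
  [forall i : 'I_N, forall j : 'I_N, (i <= j)%N ==> (Y 0 (r i) <= Y 0 (r j))].

Lemma sorts_exists (R : realType) (N : nat) (Y : 'rV[R]_N) :
  exists r : 'S_N, sorts Y r.
Proof.
pose t := [tuple Y 0 i | i < N].
have /tuple_permP[r rE] : perm_eq (sort <=%R t) t by rewrite perm_sort.
exists r; apply/forallP => i; apply/forallP => j; apply/implyP => leij.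
have nthE (k : 'I_N) : nth 0 (sort <=%R t) k = Y 0 (r k).
  by rewrite rE -(tnth_nth 0 [tuple tnth t (r i) | i < N] k) !tnth_mktuple.
rewrite -!nthE; apply: (sorted_leq_nth le_trans le_refl).
- exact: (sort_sorted le_total).
- by rewrite inE size_sort size_tuple.
- by rewrite inE size_sort size_tuple.
- exact: leij.
Qed.

Definition sorting_perm (R : realType) (N : nat) (Y : 'rV[R]_N) : 'S_N :=
  xchoose (sorts_exists Y).

(* The choice of the sorting permutation is irrelevant, even in case of ties. *)
Lemma sorts_unique_values (R : realType) (N : nat) (Y : 'rV[R]_N) (r r' : 'S_N)
    (i : 'I_N) :
  sorts Y r -> sorts Y r' -> Y 0 (r i) = Y 0 (r' i).
Proof.
pose t (q : 'S_N) := [tuple Y 0 (q i) | i < N].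
have st q : sorts Y q -> sorted <=%R (t q).
  move=> /forallP sq; apply/(sortedP 0) => k; rewrite size_tuple => ltk.
  have ltk' := ltnW ltk.
  rewrite -[k]/(val (Ordinal ltk')) -[(val _).+1]/(val (Ordinal ltk)).
  rewrite -!tnth_nth !tnth_mktuple.
  by apply: (implyP (forallP (sq _) _)) => /=.
have pt q : perm_eq (t q) (t 1%g).
  apply/tuple_permP; exists q; congr val; apply: eq_from_tnth => k.
  by rewrite !tnth_mktuple perm1.
move=> /st sr /st sr'.
have tE : t r = t r'.
  apply/val_inj/(sorted_eq le_trans le_anti) => //=.
  by rewrite (perm_trans (pt r)) // perm_sym pt.
by have := congr1 (fun u : N.-tuple R => tnth u i) tE; rewrite !tnth_mktuple.
Qed.

(* The piecewise linear function through (k / N, s k), k = 0, ..., N, to be used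
   on [0, 1] with 0 < N.  At t = 1 it uses s N.+1, with coefficient 0. *)
Definition pl_interp (R : realType) (N : nat) (s : nat -> R) (t : R) : R :=
  let k := Num.truncn (t * N%:R) in
  s k + (t * N%:R - k%:R) * (s k.+1 - s k).

Lemma pl_interpE (R : realType) (N : nat) (s : nat -> R) (k : nat) (t : R) :
  (0 < N)%N -> k%:R / N%:R <= t <= k.+1%:R / N%:R ->
  pl_interp N s t = s k + (t * N%:R - k%:R) * (s k.+1 - s k).
Proof.
move=> N0; have NR : 0 < N%:R :> R by rewrite ltr0n.
rewrite ler_pdivrMr // ler_pdivlMr // => /andP[kt tk]; rewrite /pl_interp.
have [tE|tk'] := eqVneq (t * N%:R) k.+1%:R.
  rewrite tE natrK subrr mul0r addr0 -natrB // subSnn mul1r addrC subrK //.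
suff -> : Num.truncn (t * N%:R) = k by [].
by apply: truncn_def; rewrite kt /= lt_neqAle tk' tk.
Qed.

Definition lorenz (R : realType) (N : nat) (Y : 'rV[R]_N) : R -> R :=
  pl_interp N (fun k => \sum_(i < N | (i < k)%N) Y 0 (sorting_perm Y i)).

(* With indices starting from 0, r_{N+1-i} becomes r (rev_ord i). *)
Definition dual_lorenz (R : realType) (N : nat) (Y : 'rV[R]_N) : R -> R :=
  pl_interp N
    (fun k => \sum_(i < N | (i < k)%N) Y 0 (sorting_perm Y (rev_ord i))).

Definition vmean (R : realType) (N : nat) (Y : 'rV[R]_N) : R :=
  (\sum_(i < N) Y 0 i) / N%:R.

Definition S_index (R : realType) (p : R) (N : nat) (Y : 'rV[R]_N) : R :=
  (N%:R * vmean Y)^-1 *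
  (\int[lebesgue_measure]_(t in `[0, 1]%classic)
      (`|dual_lorenz Y t - lorenz Y t| `^ p)) `^ p^-1.

(* Main.v *)
(* Adding c to all the entries keeps the sorting permutation and adds the same
   piecewise linear function, through the points (k / N, k c), to both curves.
   Hence the integral does not change, while the total N * mean increases. *)
Require Import Defs.
From mathcomp Require Import all_boot all_order all_fingroup all_algebra.
From mathcomp Require Import all_classical all_reals all_analysis.
From mathcomp Require Import ring.

Import Order.TTheory GRing.Theory Num.Theory.

Local Open Scope ring_scope.

(** The index [k] in [pl_interp] depends on [t] and [N] only, and for a fixed [k] the formula is
    linear in the sequence. *)
Lemma pl_interpD (R : realType) (N : nat) (s u : nat -> R) (t : R) :
  pl_interp N (fun k => s k + u k) t = pl_interp N s t + pl_interp N u t.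
Proof. by rewrite /pl_interp; ring. Qed.

Lemma sorts_shift (R : realType) (N : nat) (Y : 'rV[R]_N) (c : R) (r : 'S_N) :
  sorts (Y + const_mx c) r = sorts Y r.
Proof.
by apply: eq_forallb => i; apply: eq_forallb => j; rewrite !mxE lerD2r.
Qed.

(** With ties, the permutations chosen for [Y] and for the shifted vector may differ. Both sort [Y],
    however, so the sorted values agree. *)
Lemma sorting_perm_shift (R : realType) (N : nat) (Y : 'rV[R]_N) (c : R)
    (i : 'I_N) :
  (Y + const_mx c) 0 (sorting_perm (Y + const_mx c) i) =
  Y 0 (sorting_perm Y i) + c.
Proof.
rewrite !mxE; congr (_ + c); apply: sorts_unique_values; last exact: xchooseP.
by rewrite -(sorts_shift _ _ Y c); exact: xchooseP.
Qed.

Lemma lorenz_gap_shift (R : realType) (N : nat) (Y : 'rV[R]_N) (c t : R) :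
  dual_lorenz (Y + const_mx c) t - lorenz (Y + const_mx c) t =
  dual_lorenz Y t - lorenz Y t.
Proof.
(* The partial sums of the constant [c]: [k * c] up to [k = N], then constant. *)
pose C k : R := \sum_(i < N | (i < k)%N) c.
(* One statement serves both curves: [f] is [rev_ord] for the dual curve and [id] for the other. The
   added term is free of [f], so it cancels in the difference. *)
have shiftE (f : 'I_N -> 'I_N) :
    pl_interp N (fun k => \sum_(i < N | (i < k)%N)
      (Y + const_mx c) 0 (sorting_perm (Y + const_mx c) (f i))) t =
    pl_interp N (fun k => \sum_(i < N | (i < k)%N)
      Y 0 (sorting_perm Y (f i))) t + pl_interp N C t.
  rewrite -pl_interpD; congr pl_interp; apply/funext => k.
  by rewrite -big_split; apply: eq_bigr => i _; rewrite sorting_perm_shift.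
by rewrite /dual_lorenz /lorenz (shiftE (@rev_ord N)) (shiftE id) opprD addrACA subrr addr0.
Qed.

Lemma mulr_vmean (R : realType) (N : nat) (Y : 'rV[R]_N) :
  (0 < N)%N -> N%:R * vmean Y = \sum_(i < N) Y 0 i.
Proof. by move=> N0; rewrite mulrC divfK // pnatr_eq0 -lt0n. Qed.

Theorem theorem3 (R : realType) (p : R) (hp : 0 < p) (N : nat) (hN : (1 <= N)%N)
    (Y : 'rV[R]_N) (hY : forall i : 'I_N, 0 < Y 0 i) (c : R) (hc : 0 <= c) :
  S_index p (Y + const_mx c) <= S_index p Y.
Proof.
rewrite /S_index (mulr_vmean _ _ Y hN) (mulr_vmean _ _ (Y + const_mx c) hN).
under eq_Rintegral => t _ do rewrite (lorenz_gap_shift _ _ Y c t).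
apply: ler_wpM2r; first exact: powR_ge0.
(* Inversion reverses the order of positive numbers, so strict positivity is required. It comes from
   the entry of index 0, which exists by [hN]. *)
have sumY_gt0 : 0 < \sum_(i < N) Y 0 i.
  rewrite (bigD1 (Ordinal hN)) //= ltr_wpDr // sumr_ge0 // => i _.
  exact: ltW.
have le_sum : \sum_(i < N) Y 0 i <= \sum_(i < N) (Y + const_mx c) 0 i.
  by apply: ler_sum => i _; rewrite !mxE lerDl.
by rewrite lef_pV2 // posrE // (lt_le_trans sumY_gt0).
Qed.
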